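(* Let $\alpha: I\to\mathbb{R}^3$ be a space curve parametrized by arc-length $s$, with nowhere vanishing curvature, unit principal normal vector $N$ and unit Darboux vector $C$. Let $\sigma=\int_0^s\|N'(s)\|\,ds$ be the arc-length parameter of the principal normal indicatrix of $\alpha$, and regard $N$ and $C$ as functions of $\sigma$. Let $a,\theta$ be constant real numbers (with $\cot\theta$ defined), let $c\in\mathbb{R}^3$ be a constant vector, and let $\sigma_0$ be a fixed parameter value. Then $$\tilde\gamma_N(\sigma)=a\int_{\sigma_0}^{\sigma}N(\sigma)\,d\sigma+a\cot\theta\int_{\sigma_0}^{\sigma}C(\sigma)\,d\sigma+c$$ is a Bertrand curve.
   Context: For a unit speed curve $\alpha$ in $\mathbb{R}^3$: $T=\alpha'$, the curvature is $\kappa=\|\alpha''\|$, and where $\kappa\neq0$ the unit principal normal $N$ is defined by $\alpha''=\kappa N$ and the unit binormal is $B=T\times N$. The torsion $\tau$ is defined by the Frenet-Serret formulae $T'=\kappa N$, $N'=-\kappa T+\tau B$, $B'=-\tau N$. The Darboux vector field is $W=\tau T+\kappa B$ and the unit Darboux vector is $C=W/\|W\|=\dfrac{\tau T+\kappa B}{\sqrt{\tau^2+\kappa^2}}$. The principal normal indicatrix $(N)$ is the curve on the unit sphere $\mathbb{S}^2$ traced by $N(s)$. Convention: curves are regular and, wherever the Frenet frame is used, have nowhere vanishing curvature; this applies also to the curve $\tilde\gamma_N$ (i.e. $a,\theta$ are such that it is a regular curve with nonvanishing curvature). A Bertrand curve is a curve in $\mathbb{R}^3$ which shares its principal normals with another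 curve (its Bertrand mate). The characterization used in the paper: a curve with curvature $\kappa$ and torsion $\tau$ is a Bertrand curve if and only if there exist non-zero real numbers $A,B$ such that $A\kappa+B\tau=1$ at every parameter value.
   Formalization: The relation Aκ+Bτ=1 with non-zero A, B is claimed only for cot θ ≠ 0 (at cot θ = 0 it fails when the torsion is nonconstant); for all θ a Bertrand mate is given, but the mate may have cusps or inflections, having only a unit tangent field whose derivative is along the shared normal. *)

(* Defs.v *)
(* Stdlib reals with Coquelicot. *)
From Stdlib Require Import Reals.
From Coquelicot Require Import Coquelicot.
Open Scope R_scope.

Definition vec3 : Type := (R * R * R)%type.

Definition x1 (v : vec3) : R := fst (fst v).
Definition x2 (v : vec3) : R := snd (fst v).
Definition x3 (v : vec3) : R := snd v.

Definition zero3 : vec3 := (0, 0, 0).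
Definition add3 (v w : vec3) : vec3 := (x1 v + x1 w, x2 v + x2 w, x3 v + x3 w).
Definition scal3 (r : R) (v : vec3) : vec3 := (r * x1 v, r * x2 v, r * x3 v).
Definition dot3 (v w : vec3) : R := x1 v * x1 w + x2 v * x2 w + x3 v * x3 w.
Definition norm3 (v : vec3) : R := sqrt (dot3 v v).
Definition cross3 (v w : vec3) : vec3 :=
  (x2 v * x3 w - x3 v * x2 w,
   x3 v * x1 w - x1 v * x3 w,
   x1 v * x2 w - x2 v * x1 w).

Definition smooth3 (I : R -> Prop) (f : R -> vec3) : Prop :=
  forall (n : nat) (t : R), I t ->
    ex_derive_n (fun u => x1 (f u)) n t /\
    ex_derive_n (fun u => x2 (f u)) n t /\
    ex_derive_n (fun u => x3 (f u)) n t.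

Definition is_derive3 (f : R -> vec3) (t : R) (v : vec3) : Prop :=
  is_derive (fun u => x1 (f u)) t (x1 v) /\
  is_derive (fun u => x2 (f u)) t (x2 v) /\
  is_derive (fun u => x3 (f u)) t (x3 v).

Definition Derive3 (f : R -> vec3) (t : R) : vec3 :=
  (Derive (fun u => x1 (f u)) t,
   Derive (fun u => x2 (f u)) t,
   Derive (fun u => x3 (f u)) t).

Definition RInt3 (f : R -> vec3) (a b : R) : vec3 :=
  (RInt (fun u => x1 (f u)) a b,
   RInt (fun u => x2 (f u)) a b,
   RInt (fun u => x3 (f u)) a b).

(* Derivative of [f] with respect to the arc length of the regular curve
   [gamma], both being given as functions of a common parameter t:
   d/ds = (1 / |gamma'(t)|) d/dt.  It is the ordinary derivative when [gamma]
   has unit speed, so that the definitions below are then literally T = gamma',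
   kappa = |gamma''|, gamma'' = kappa N, B = T x N and B' = - tau N. *)
Definition Darc (gamma f : R -> vec3) (t : R) : vec3 :=
  scal3 (/ norm3 (Derive3 gamma t)) (Derive3 f t).

Definition tangent (gamma : R -> vec3) (t : R) : vec3 := Darc gamma gamma t.

Definition curvature (gamma : R -> vec3) (t : R) : R :=
  norm3 (Darc gamma (tangent gamma) t).

Definition normal (gamma : R -> vec3) (t : R) : vec3 :=
  scal3 (/ curvature gamma t) (Darc gamma (tangent gamma) t).

Definition binormal (gamma : R -> vec3) (t : R) : vec3 :=
  cross3 (tangent gamma t) (normal gamma t).

Definition torsion (gamma : R -> vec3) (t : R) : R :=
  - dot3 (Darc gamma (binormal gamma) t) (normal gamma t).

Definition darboux (gamma : R -> vec3) (t : R) : vec3 :=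
  add3 (scal3 (torsion gamma t) (tangent gamma t))
       (scal3 (curvature gamma t) (binormal gamma t)).

Definition unit_darboux (gamma : R -> vec3) (t : R) : vec3 :=
  scal3 (/ norm3 (darboux gamma t)) (darboux gamma t).

Definition in_interval (lo hi : Rbar) (t : R) : Prop :=
  Rbar_lt lo t /\ Rbar_lt t hi.

Definition regular_on (J : R -> Prop) (gamma : R -> vec3) : Prop :=
  forall t, J t -> Derive3 gamma t <> zero3.

Definition nonzero_curvature_on (J : R -> Prop) (gamma : R -> vec3) : Prop :=
  forall t, J t -> curvature gamma t <> 0.

Definition indicatrix_arclength (alpha : R -> vec3) (s : R) : R :=
  RInt (fun u => norm3 (Derive3 (normal alpha) u)) 0 s.

Definition indicatrix_domain (I : R -> Prop) (alpha : R -> vec3) (u : R) : Prop :=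
  exists s, I s /\ indicatrix_arclength alpha s = u.

(* [s_of] expresses the arc length of [alpha] as a function of sigma. *)
Definition gamma_N (alpha : R -> vec3) (s_of : R -> R) (a theta : R)
    (c : vec3) (sigma0 sigma : R) : vec3 :=
  add3
    (add3
      (scal3 a (RInt3 (fun u => normal alpha (s_of u)) sigma0 sigma))
      (scal3 (a * (cos theta / sin theta))
             (RInt3 (fun u => unit_darboux alpha (s_of u)) sigma0 sigma)))
    c.

(* [beta] is another curve with the same principal normal lines as [gamma]:
   beta(t) is a point other than gamma(t) of the principal normal line of
   gamma at t, and this line is also the principal normal line of beta.
   The latter is expressed through a unit tangent field V of beta,
   beta' = v V and V' = k N, where N is the principal normal of gamma; wherever
   beta is regular with nonzero curvature (v <> 0 and k <> 0) this says that N
   is, up to sign, the Frenet normal of beta.  The equations still make sense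
   at a cusp or an inflection of beta, and such points cannot be excluded: for
   A kappa + B tau = 1 with A <> 0, the curve beta = gamma + A N has
   beta' = tau |gamma'| (B T + A (T x N)), which vanishes where tau does. *)
Definition bertrand_mate (J : R -> Prop) (gamma beta : R -> vec3) : Prop :=
  exists V : R -> vec3, forall t, J t ->
    (exists r, r <> 0 /\ beta t = add3 (gamma t) (scal3 r (normal gamma t))) /\
    norm3 (V t) = 1 /\
    dot3 (V t) (normal gamma t) = 0 /\
    (exists v, is_derive3 beta t (scal3 v (V t))) /\
    (exists k, is_derive3 V t (scal3 k (normal gamma t))).

Definition is_bertrand (J : R -> Prop) (gamma : R -> vec3) : Prop :=
  exists beta, bertrand_mate J gamma beta.

Definition bertrand_relation (J : R -> Prop) (gamma : R -> vec3) : Prop :=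
  exists A B : R, A <> 0 /\ B <> 0 /\
    forall t, J t -> A * curvature gamma t + B * torsion gamma t = 1.

(* Main.v *)
(** N is a spherical curve; parametrised by its arc length sigma it has the
    orthonormal frame (N, E, C) with E = dN/dsigma and C = N x E, and C is
    exactly the unit Darboux vector.  With g the geodesic curvature,
    N' = E, E' = - N - g C, C' = g E.  Writing q = cot theta, the curve gamma has
    velocity a (N + q C), hence constant speed w = |a| sqrt (1 + q^2), and its
    Frenet normal is E up to sign.  With d the constant sign of 1 + q g,
      kappa = |a| d (1 + q g) / w^2,   tau = a (q - g) / w^2,
    so g is eliminated by  |a| d kappa + a q tau = 1.  The mate is gamma + a E,
    whose velocity a (q - g) C stays along C. *)
Require Import Defs.
From Stdlib Require Import Reals Lra Ranalysis5.
From Coquelicot Require Import Coquelicot.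
Open Scope R_scope.

(** * Vector algebra in three dimensions *)

Lemma vec3_ext (v w : vec3) :
  x1 v = x1 w -> x2 v = x2 w -> x3 v = x3 w -> v = w.
Proof.
destruct v as [[v1 v2] v3], w as [[w1 w2] w3].
unfold x1, x2, x3; simpl; congruence.
Qed.

Ltac vec_unfold :=
  unfold zero3, cross3, add3, scal3, dot3, x1, x2, x3 in *; simpl in *.
Ltac vec_ring := apply vec3_ext; vec_unfold; ring.

Lemma dot3_comm v w : dot3 v w = dot3 w v.
Proof. vec_unfold; ring. Qed.
Lemma dot3_add_l u v w : dot3 (add3 u v) w = dot3 u w + dot3 v w.
Proof. vec_unfold; ring. Qed.
Lemma dot3_add_r u v w : dot3 w (add3 u v) = dot3 w u + dot3 w v.
Proof. vec_unfold; ring. Qed.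
Lemma dot3_scal_l r v w : dot3 (scal3 r v) w = r * dot3 v w.
Proof. vec_unfold; ring. Qed.
Lemma dot3_scal_r r v w : dot3 w (scal3 r v) = r * dot3 w v.
Proof. vec_unfold; ring. Qed.
Lemma dot3_cross_l v w : dot3 v (cross3 v w) = 0.
Proof. vec_unfold; ring. Qed.
Lemma dot3_cross_r v w : dot3 w (cross3 v w) = 0.
Proof. vec_unfold; ring. Qed.
Lemma scal3_assoc r t v : scal3 r (scal3 t v) = scal3 (r * t) v.
Proof. vec_ring. Qed.
Lemma scal3_1 v : scal3 1 v = v.
Proof. vec_ring. Qed.

Lemma dot3_self_ge0 v : 0 <= dot3 v v.
Proof.
unfold dot3.
generalize (Rle_0_sqr (x1 v)) (Rle_0_sqr (x2 v)) (Rle_0_sqr (x3 v)).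
unfold Rsqr; lra.
Qed.

Lemma norm3_sqr v : norm3 v * norm3 v = dot3 v v.
Proof. apply sqrt_sqrt, dot3_self_ge0. Qed.

Lemma norm3_ge0 v : 0 <= norm3 v.
Proof. apply sqrt_pos. Qed.

Lemma norm3_scal r v : norm3 (scal3 r v) = Rabs r * norm3 v.
Proof.
unfold norm3; rewrite dot3_scal_l, dot3_scal_r, <- Rmult_assoc.
rewrite sqrt_mult_alt by apply Rle_0_sqr.
now rewrite <- sqrt_Rsqr_abs.
Qed.

Lemma norm3_eq1 v : dot3 v v = 1 -> norm3 v = 1.
Proof. intros H; unfold norm3; rewrite H; apply sqrt_1. Qed.

Lemma dot3_eq1 v : norm3 v = 1 -> dot3 v v = 1.
Proof. intros H; rewrite <- norm3_sqr, H; ring. Qed.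

Lemma norm3_unit v : norm3 v <> 0 -> norm3 (scal3 (/ norm3 v) v) = 1.
Proof.
intros H; rewrite norm3_scal, Rabs_inv, Rabs_pos_eq by apply norm3_ge0.
now apply Rinv_l.
Qed.

Lemma dot3_cross_self v w :
  dot3 (cross3 v w) (cross3 v w) = dot3 v v * dot3 w w - dot3 v w * dot3 v w.
Proof. vec_unfold; ring. Qed.

Lemma orthonormal_expansion T N v :
  dot3 T T = 1 -> dot3 N N = 1 -> dot3 T N = 0 ->
  v = add3 (add3 (scal3 (dot3 v T) T) (scal3 (dot3 v N) N))
           (scal3 (dot3 v (cross3 T N)) (cross3 T N)).
Proof.
intros HT HN HTN.
(* Gram's identity, valid for all T and N. *)
assert (G : scal3 (dot3 T T * dot3 N N - dot3 T N * dot3 T N) v =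
  add3 (add3 (scal3 (dot3 v T * dot3 N N - dot3 v N * dot3 T N) T)
             (scal3 (dot3 v N * dot3 T T - dot3 v T * dot3 T N) N))
       (scal3 (dot3 v (cross3 T N)) (cross3 T N))) by vec_ring.
rewrite HT, HN, HTN in G.
(* Under orthonormality the Gram determinant is [1 * 1 - 0 * 0]; writing [v] as [1 v] exposes the
   left side of [G]. *)
rewrite <- (scal3_1 v) at 1.
replace 1 with (1 * 1 - 0 * 0) by ring; rewrite G.
vec_ring.
Qed.

(** * Vector calculus *)

Lemma is_derive_eq (f : R -> R) t (l l' : R) :
  is_derive f t l -> l = l' -> is_derive f t l'.
Proof. now intros H <-. Qed.

Lemma is_derive3_eq f t v w : is_derive3 f t v -> v = w -> is_derive3 f t w.
Proof. now intros H <-. Qed.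

Lemma Derive3_eq f t v : is_derive3 f t v -> Derive3 f t = v.
Proof.
intros (H1 & H2 & H3).
apply vec3_ext; apply is_derive_unique; assumption.
Qed.

Lemma is_derive3_ext_loc f g t v :
  locally t (fun u => f u = g u) -> is_derive3 f t v -> is_derive3 g t v.
Proof.
intros L (H1 & H2 & H3); split; [| split];
  (eapply is_derive_ext_loc; [| eassumption]);
  revert L; apply filter_imp; intros u ->; reflexivity.
Qed.

Lemma is_derive_mul (f g : R -> R) t df dg :
  is_derive f t df -> is_derive g t dg ->
  is_derive (fun u => f u * g u) t (df * g t + f t * dg).
Proof.
intros Hf Hg; apply (is_derive_mult f g t df dg Hf Hg); intros; apply Rmult_comm.
Qed.

Lemma is_derive_add (f g : R -> R) t df dg :
  is_derive f t df -> is_derive g t dg ->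
  is_derive (fun u => f u + g u) t (df + dg).
Proof. intros Hf Hg; exact (is_derive_plus f g t df dg Hf Hg). Qed.

Lemma is_derive_sub (f g : R -> R) t df dg :
  is_derive f t df -> is_derive g t dg ->
  is_derive (fun u => f u - g u) t (df - dg).
Proof. intros Hf Hg; exact (is_derive_minus f g t df dg Hf Hg). Qed.

Lemma is_derive3_add f g t v w :
  is_derive3 f t v -> is_derive3 g t w ->
  is_derive3 (fun u => add3 (f u) (g u)) t (add3 v w).
Proof.
intros (F1 & F2 & F3) (G1 & G2 & G3).
exact (conj (is_derive_add _ _ _ _ _ F1 G1)
  (conj (is_derive_add _ _ _ _ _ F2 G2) (is_derive_add _ _ _ _ _ F3 G3))).
Qed.

Lemma is_derive3_scal r f t v :
  is_derive3 f t v -> is_derive3 (fun u => scal3 r (f u)) t (scal3 r v).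
Proof.
intros (F1 & F2 & F3).
exact (conj (is_derive_scal _ t r _ F1)
  (conj (is_derive_scal _ t r _ F2) (is_derive_scal _ t r _ F3))).
Qed.

Lemma is_derive3_const c t : is_derive3 (fun _ => c) t zero3.
Proof.
assert (H : forall k : R, is_derive (fun _ : R => k) t 0)
  by (intros k; exact (is_derive_const (K:=R_AbsRing) (V:=R_NormedModule) k t)).
exact (conj (H _) (conj (H _) (H _))).
Qed.

Lemma is_derive3_cross f g t v w :
  is_derive3 f t v -> is_derive3 g t w ->
  is_derive3 (fun u => cross3 (f u) (g u)) t
    (add3 (cross3 v (g t)) (cross3 (f t) w)).
Proof.
intros (F1 & F2 & F3) (G1 & G2 & G3).
assert (M := is_derive_mul).
split; [| split]; (eapply is_derive_eq; [refine (is_derive_sub _ _ _ _ _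
  (M _ _ _ _ _ _ _) (M _ _ _ _ _ _ _)); eassumption | vec_unfold; ring]).
Qed.

Lemma is_derive_dot3 f g t v w :
  is_derive3 f t v -> is_derive3 g t w ->
  is_derive (fun u => dot3 (f u) (g u)) t (dot3 v (g t) + dot3 (f t) w).
Proof.
intros (F1 & F2 & F3) (G1 & G2 & G3); eapply is_derive_eq.
- apply is_derive_add; [apply is_derive_add |]; apply is_derive_mul; eassumption.
- vec_unfold; ring.
Qed.

Lemma is_derive3_comp f g t v d :
  is_derive3 f (g t) v -> is_derive g t d ->
  is_derive3 (fun u => f (g u)) t (scal3 d v).
Proof.
intros (F1 & F2 & F3) G; split; [| split].
- exact (is_derive_comp (fun u => x1 (f u)) g t _ _ F1 G).
- exact (is_derive_comp (fun u => x2 (f u)) g t _ _ F2 G).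
- exact (is_derive_comp (fun u => x3 (f u)) g t _ _ F3 G).
Qed.

(** The product rule is compared with the zero derivative of a constant; openness of [J] makes the
    equality hold near [t]. Differentiating orthonormality relations in this way yields the
    coefficients of the frame equations. *)
Lemma dot3_derive_const (J : R -> Prop) f g (k : R) t v w :
  open J -> J t -> (forall u, J u -> dot3 (f u) (g u) = k) ->
  is_derive3 f t v -> is_derive3 g t w ->
  dot3 v (g t) + dot3 (f t) w = 0.
Proof.
intros HJ Jt Hk Hf Hg.
rewrite <- (is_derive_unique _ _ _ (is_derive_dot3 _ _ _ _ _ Hf Hg)).
apply is_derive_unique, (is_derive_ext_loc (fun _ => k)).
- generalize (HJ t Jt); apply filter_imp; intros u Ju; symmetry; now apply Hk.
- exact (is_derive_const (K:=R_AbsRing) (V:=R_NormedModule) _ _).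
Qed.

Lemma unit3_derive_orth (J : R -> Prop) f t v :
  open J -> J t -> (forall u, J u -> norm3 (f u) = 1) ->
  is_derive3 f t v -> dot3 v (f t) = 0.
Proof.
intros HJ Jt H1 Hf.
assert (E : dot3 v (f t) + dot3 (f t) v = 0)
  by (apply (dot3_derive_const J f f 1 t v v); auto using dot3_eq1).
rewrite (dot3_comm (f t)) in E; lra.
Qed.

(** * Smooth functions on an open set *)

(** The recursion strips the first derivative, whereas [ex_derive_n] strips the last. Closure under
    sums, products, inverses and square roots then follows by induction on [n] from the rule for a
    single derivative. *)
Fixpoint diff_n (O : R -> Prop) (n : nat) (f : R -> R) : Prop :=
  match n with
  | 0 => True
  | S n => (forall t, O t -> ex_derive f t) /\ diff_n O n (Derive f)
  end.

Definition smooth_on (O : R -> Prop) (f : R -> R) : Prop :=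
  forall n, diff_n O n f.

Lemma diff_n_ext O n : open O ->
  forall f g, (forall t, O t -> f t = g t) -> diff_n O n f -> diff_n O n g.
Proof.
intros HO; induction n as [| n IH]; intros f g E; [easy |].
assert (L : forall t, O t -> locally t (fun u => f u = g u))
  by (intros t Ot; exact (filter_imp _ _ E (HO t Ot))).
intros [D1 D2]; split.
- intros t Ot; apply (ex_derive_ext_loc f); auto.
- apply (IH (Derive f)); [| assumption].
  intros t Ot; apply Derive_ext_loc; auto.
Qed.

Lemma diff_n_pred O n f : diff_n O (S n) f -> diff_n O n f.
Proof.
revert f; induction n as [| n IH]; intros f; [easy |].
intros [D1 D2]; split; auto.
Qed.

Lemma diff_n_intro O n f (f' : R -> R) : open O ->
  (forall t, O t -> is_derive f t (f' t)) -> diff_n O n f' -> diff_n O (S n) f.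
Proof.
intros HO D D'; split.
- intros t Ot; exists (f' t); auto.
- apply (diff_n_ext O n HO f'); [| assumption].
  intros t Ot; symmetry; apply is_derive_unique; auto.
Qed.

Lemma diff_n_is_derive O n f t :
  diff_n O (S n) f -> O t -> is_derive f t (Derive f t).
Proof. intros [D _] Ot; apply Derive_correct; auto. Qed.

Lemma diff_n_add O n f g : open O ->
  diff_n O n f -> diff_n O n g -> diff_n O n (fun t => f t + g t).
Proof.
intros HO; revert f g; induction n as [| n IH]; intros f g F G; [easy |].
apply (diff_n_intro _ _ _ (fun t => Derive f t + Derive g t) HO).
- intros t Ot; apply is_derive_add; eapply diff_n_is_derive; eassumption.
- apply IH; [apply F | apply G].
Qed.

Lemma diff_n_mul O n f g : open O ->
  diff_n O n f -> diff_n O n g -> diff_n O n (fun t => f t * g t).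
Proof.
intros HO; revert f g; induction n as [| n IH]; intros f g F G; [easy |].
apply (diff_n_intro _ _ _ (fun t => Derive f t * g t + f t * Derive g t) HO).
- intros t Ot; apply is_derive_mul; eapply diff_n_is_derive; eassumption.
- apply diff_n_add; [assumption | |]; apply IH; try apply F; try apply G;
    now apply diff_n_pred.
Qed.

Lemma diff_n_const O n k : open O -> diff_n O n (fun _ => k).
Proof.
intros HO; revert k; induction n as [| n IH]; intros k; [easy |].
apply (diff_n_intro _ _ _ (fun _ => 0) HO); auto.
intros t _; exact (is_derive_const (K:=R_AbsRing) (V:=R_NormedModule) _ _).
Qed.

(** The derivative of [/ f] is a product of [Derive f] and two copies of [/ f] itself, and the
    induction hypothesis covers the latter at order [n]. The square root below follows the same
    pattern, with derivative [Derive f] over twice the root. *)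
Lemma diff_n_inv O n f : open O -> (forall t, O t -> f t <> 0) ->
  diff_n O n f -> diff_n O n (fun t => / f t).
Proof.
intros HO Hf; induction n as [| n IH]; intros F; [easy |].
assert (I := IH (diff_n_pred _ _ _ F)).
apply (diff_n_intro _ _ _ (fun t => (-1 * Derive f t) * (/ f t * / f t)) HO).
- intros t Ot; eapply is_derive_eq.
  + apply is_derive_inv; [eapply diff_n_is_derive; eassumption | auto].
  + field; auto.
- repeat apply diff_n_mul; auto; [now apply diff_n_const | apply F].
Qed.

Lemma diff_n_sqrt O n f : open O -> (forall t, O t -> 0 < f t) ->
  diff_n O n f -> diff_n O n (fun t => sqrt (f t)).
Proof.
intros HO Hf; induction n as [| n IH]; intros F; [easy |].
assert (I := IH (diff_n_pred _ _ _ F)).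
assert (Hs : forall t, O t -> sqrt (f t) <> 0)
  by (intros t Ot; apply Rgt_not_eq, sqrt_lt_R0; auto).
apply (diff_n_intro _ _ _ (fun t => / 2 * Derive f t * / sqrt (f t)) HO).
- intros t Ot; eapply is_derive_eq.
  + apply is_derive_sqrt; [eapply diff_n_is_derive; eassumption | auto].
  + simpl; field; auto.
- apply diff_n_mul; auto; [apply diff_n_mul; auto |].
  + now apply diff_n_const.
  + apply F.
  + now apply diff_n_inv.
Qed.

Lemma smooth_on_ext O f g : open O -> (forall t, O t -> f t = g t) ->
  smooth_on O f -> smooth_on O g.
Proof. intros HO E F n; now apply (diff_n_ext O n HO f). Qed.

Lemma smooth_on_add O f g : open O ->
  smooth_on O f -> smooth_on O g -> smooth_on O (fun t => f t + g t).
Proof. intros HO F G n; now apply diff_n_add. Qed.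

Lemma smooth_on_mul O f g : open O ->
  smooth_on O f -> smooth_on O g -> smooth_on O (fun t => f t * g t).
Proof. intros HO F G n; now apply diff_n_mul. Qed.

Lemma smooth_on_const O k : open O -> smooth_on O (fun _ => k).
Proof. intros HO n; now apply diff_n_const. Qed.

Lemma smooth_on_sub O f g : open O ->
  smooth_on O f -> smooth_on O g -> smooth_on O (fun t => f t - g t).
Proof.
intros HO F G; apply (smooth_on_ext O (fun t => f t + (-1) * g t) _ HO).
- intros; ring.
- apply smooth_on_add; auto; apply smooth_on_mul; auto.
  now apply smooth_on_const.
Qed.

Lemma smooth_on_inv O f : open O -> (forall t, O t -> f t <> 0) ->
  smooth_on O f -> smooth_on O (fun t => / f t).
Proof. intros HO Hf F n; now apply diff_n_inv. Qed.

Lemma smooth_on_Derive O f : smooth_on O f -> smooth_on O (Derive f).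
Proof. intros F n; exact (proj2 (F (S n))). Qed.

Lemma smooth_on_ex_derive O f t : smooth_on O f -> O t -> ex_derive f t.
Proof. intros F Ot; exact (proj1 (F 1%nat) t Ot). Qed.

Lemma smooth_on_continuous O f t : smooth_on O f -> O t -> continuous f t.
Proof. intros F Ot; apply (ex_derive_continuous (K:=R_AbsRing) (V:=R_NormedModule)); eapply smooth_on_ex_derive; eauto. Qed.

Lemma ex_derive_n_smooth_on O f :
  (forall n t, O t -> ex_derive_n f n t) -> smooth_on O f.
Proof.
intros H n.
(* The claim is generalised to all iterated derivatives, since [Derive (Derive_n f k)] is
   [Derive_n f (S k)] by computation. *)
assert (G : forall k, diff_n O n (Derive_n f k)); [| exact (G 0%nat)].
induction n as [| n IH]; intros k; [easy |].
split; [exact (H (S k)) | exact (IH (S k))].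
Qed.

Definition smooth3_on (O : R -> Prop) (f : R -> vec3) : Prop :=
  smooth_on O (fun t => x1 (f t)) /\ smooth_on O (fun t => x2 (f t)) /\
  smooth_on O (fun t => x3 (f t)).

Lemma smooth3_smooth3_on O f : smooth3 O f -> smooth3_on O f.
Proof.
intros H; split; [| split]; apply ex_derive_n_smooth_on; intros n t Ot;
  apply (H n t Ot).
Qed.

Lemma smooth3_on_derive O f t :
  smooth3_on O f -> O t -> is_derive3 f t (Derive3 f t).
Proof.
intros (F1 & F2 & F3) Ot; split; [| split]; apply Derive_correct;
  eapply smooth_on_ex_derive; eassumption.
Qed.

Lemma smooth3_on_Derive3 O f : smooth3_on O f -> smooth3_on O (Derive3 f).
Proof.
intros (F1 & F2 & F3); split; [| split]; now apply smooth_on_Derive.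
Qed.

Lemma smooth_on_dot3 O f g : open O ->
  smooth3_on O f -> smooth3_on O g -> smooth_on O (fun t => dot3 (f t) (g t)).
Proof.
intros HO (F1 & F2 & F3) (G1 & G2 & G3).
repeat apply smooth_on_add; auto; now apply smooth_on_mul.
Qed.

Lemma smooth3_on_cross O f g : open O ->
  smooth3_on O f -> smooth3_on O g ->
  smooth3_on O (fun t => cross3 (f t) (g t)).
Proof.
intros HO (F1 & F2 & F3) (G1 & G2 & G3).
split; [| split]; apply smooth_on_sub; auto; now apply smooth_on_mul.
Qed.

Lemma smooth3_on_scal O (r : R -> R) f : open O ->
  smooth_on O r -> smooth3_on O f -> smooth3_on O (fun t => scal3 (r t) (f t)).
Proof.
intros HO Hr (F1 & F2 & F3).
split; [| split]; now apply smooth_on_mul.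
Qed.

Lemma smooth_on_norm3 O f : open O -> (forall t, O t -> norm3 (f t) <> 0) ->
  smooth3_on O f -> smooth_on O (fun t => norm3 (f t)).
Proof.
intros HO Hf F n; apply diff_n_sqrt; auto.
- intros t Ot; rewrite <- norm3_sqr.
  assert (H := Rsqr_pos_lt _ (Hf t Ot)); exact H.
- now apply smooth_on_dot3.
Qed.

Lemma smooth3_on_normalize O f : open O ->
  (forall t, O t -> norm3 (f t) <> 0) -> smooth3_on O f ->
  smooth3_on O (fun t => scal3 (/ norm3 (f t)) (f t)).
Proof.
intros HO Hf F; apply smooth3_on_scal; auto.
apply smooth_on_inv; auto; now apply smooth_on_norm3.
Qed.

Lemma smooth3_on_Darc O gamma f : open O ->
  (forall t, O t -> norm3 (Derive3 gamma t) <> 0) ->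
  smooth3_on O gamma -> smooth3_on O f -> smooth3_on O (Darc gamma f).
Proof.
intros HO Hg G F; apply smooth3_on_scal; auto.
- apply smooth_on_inv; auto.
  apply smooth_on_norm3; auto; now apply smooth3_on_Derive3.
- now apply smooth3_on_Derive3.
Qed.
(** * Intervals *)

Definition convex (O : R -> Prop) : Prop :=
  forall x y z, O x -> O y -> x <= z <= y -> O z.

Lemma in_interval_open lo hi : open (in_interval lo hi).
Proof.
intros t [H1 H2]; apply (locally_interval _ t lo hi H1 H2); now split.
Qed.

Lemma in_interval_convex lo hi : convex (in_interval lo hi).
Proof.
intros x y z [Hx _] [_ Hy] [H1 H2]; split.
- now apply (Rbar_lt_le_trans _ x).
- now apply (Rbar_le_lt_trans _ y).
Qed.

Lemma open_ball_interval (O : R -> Prop) t : open O -> O t ->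
  exists d, 0 < d /\ O (t - d) /\ O (t + d).
Proof.
intros HO Ot; destruct (HO t Ot) as [e He].
assert (H := cond_pos e).
exists (e / 2); split; [lra | split]; apply He; unfold ball; simpl;
  unfold AbsRing_ball, abs, minus, plus, opp; simpl;
  apply Rabs_def1; lra.
Qed.

(** Convexity keeps the segment from [a] to any nearby [y] inside [O], so continuity on [O] gives
    integrability there and the fundamental theorem of calculus applies. *)
Lemma is_derive_RInt_convex O (f : R -> R) a x :
  open O -> convex O -> (forall t, O t -> continuous f t) -> O a -> O x ->
  is_derive (fun y => RInt f a y) x (f x).
Proof.
intros HO HC Hf Oa Ox.
apply (is_derive_RInt f _ a x); [| auto].
generalize (HO x Ox); apply filter_imp; intros y Oy.
apply (RInt_correct f), (ex_RInt_continuous f); intros z Hz; apply Hf.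
unfold Rmin, Rmax in Hz; destruct (Rle_dec a y);
  [apply (HC a y) | apply (HC y a)]; auto.
Qed.

Lemma nonzero_same_sign O (f : R -> R) x y : convex O ->
  (forall t, O t -> continuous f t) -> (forall t, O t -> f t <> 0) ->
  O x -> O y -> 0 < f x -> 0 < f y.
Proof.
intros HC Hf H0 Ox Oy Hx.
assert (K : forall t, O t -> continuity_pt f t)
  by (intros t Ot; apply continuity_pt_filterlim; now apply Hf).
destruct (Rlt_or_le 0 (f y)) as [| Hy]; [assumption | exfalso].
assert (Hy' : f y < 0) by (generalize (H0 y Oy); lra).
destruct (Rtotal_order x y) as [L | [L | L]]; [| subst; lra |].
(* [IVT_interv] expects a negative value at the left end and a positive one at the right, hence
   [- f] when [x < y] and [f] itself in the other order. *)
- destruct (IVT_interv (fun t => - f t) x y) as [z [Hz E]]; try lra.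
  + intros t Ht; apply continuity_pt_opp, K, (HC x y); auto.
  + apply (H0 z); [now apply (HC x y) | lra].
- destruct (IVT_interv f y x) as [z [Hz E]]; try lra.
  + intros t Ht; apply K, (HC y x); auto.
  + apply (H0 z); [now apply (HC y x) | assumption].
Qed.

(** For [L] the arc length of the indicatrix this is convertible to [indicatrix_domain], so the
    lemmas below apply directly to that domain. *)
Definition image (O : R -> Prop) (L : R -> R) (u : R) : Prop :=
  exists s, O s /\ L s = u.

Lemma image_intermediate O (L : R -> R) x y u : convex O ->
  (forall s, O s -> continuous L s) ->
  O x -> O y -> x < y -> L x <= u <= L y -> exists s, x <= s <= y /\ L s = u.
Proof.
intros HC HL Ox Oy Hxy Hu.
destruct (f_interv_is_interv L x y u Hxy Hu) as [s Hs]; [| now exists s].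
intros t Ht; apply continuity_pt_filterlim, HL, (HC x y); auto.
Qed.

Lemma positive_derive_increasing O (L l : R -> R) x y : convex O ->
  (forall s, O s -> is_derive L s (l s)) -> (forall s, O s -> 0 < l s) ->
  O x -> O y -> x < y -> L x < L y.
Proof.
intros HC HL Hl Ox Oy Hxy.
assert (HO : forall z, x <= z <= y -> O z) by (intros; now apply (HC x y)).
destruct (MVT_cor2 L l x y Hxy) as [z [E Hz]].
- intros z Hz; apply is_derive_Reals; auto.
- assert (0 < l z * (y - x)); [| lra].
  apply Rmult_lt_0_compat; [apply Hl, HO |]; lra.
Qed.

Lemma image_convex O (L l : R -> R) : convex O ->
  (forall s, O s -> is_derive L s (l s)) -> (forall s, O s -> 0 < l s) ->
  convex (image O L).
Proof.
intros HC HL Hl u1 u2 u [s1 [O1 <-]] [s2 [O2 <-]] Hu.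
destruct (Rtotal_order s1 s2) as [H | [H | H]].
- destruct (image_intermediate O L s1 s2 u) as [s [Hs E]]; auto.
  + intros t Ot; apply (ex_derive_continuous (K:=R_AbsRing) (V:=R_NormedModule)).
    exists (l t); auto.
  + exists s; split; [now apply (HC s1 s2) | assumption].
- subst; exists s2; split; [assumption | lra].
- assert (L s2 < L s1) by (apply (positive_derive_increasing O L l); auto); lra.
Qed.

(** Monotonicity puts [L s] strictly between two further values of [L], and convexity of the image
    fills the interval between them. *)
Lemma image_open O (L l : R -> R) : open O -> convex O ->
  (forall s, O s -> is_derive L s (l s)) -> (forall s, O s -> 0 < l s) ->
  open (image O L).
Proof.
intros HO HC HL Hl u [s [Os <-]].
destruct (open_ball_interval O s HO Os) as [d [Hd [O1 O2]]].
assert (Hi := fun x y => positive_derive_increasing O L l x y HC HL Hl).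
assert (I1 : L (s - d) < L s) by (apply Hi; auto; lra).
assert (I2 : L s < L (s + d)) by (apply Hi; auto; lra).
apply (locally_interval _ (L s) (L (s - d)) (L (s + d)) I1 I2).
simpl; intros u H1 H2.
apply (image_convex O L l HC HL Hl (L (s - d)) (L (s + d))); [| | lra];
  eexists; eauto.
Qed.

(** Differentiability of [S] comes first, from the inverse function theorem on a compact interval
    around [s]. The value of the derivative then follows by differentiating [S (L t) = t]. *)
Lemma is_derive_left_inverse O (L l S : R -> R) s : open O -> convex O ->
  (forall t, O t -> is_derive L t (l t)) -> (forall t, O t -> 0 < l t) ->
  (forall t, O t -> S (L t) = t) -> O s -> is_derive S (L s) (/ l s).
Proof.
intros HO HC HL Hl HS Os.
destruct (open_ball_interval O s HO Os) as [d [Hd [O1 O2]]].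
assert (Hi := fun x y => positive_derive_increasing O L l x y HC HL Hl).
assert (HO' : forall t, s - d <= t <= s + d -> O t)
  by (intros; now apply (HC (s - d) (s + d))).
assert (Hd' : s - d < s + d) by lra.
assert (Hc : forall t, O t -> continuous L t).
{ intros t Ot; apply (ex_derive_continuous (K:=R_AbsRing) (V:=R_NormedModule)).
  exists (l t); auto. }
assert (Hu : L (s - d) < L s < L (s + d)) by (split; apply Hi; auto; lra).
(* By the intermediate value theorem each such [u] is some [L t], so the left inverse is also a
   right inverse on this interval. *)
assert (Hinv : forall u, L (s - d) <= u -> u <= L (s + d) ->
  (s - d <= S u <= s + d) /\ L (S u) = u).
{ intros u H1 H2.
  destruct (image_intermediate O L (s - d) (s + d) u) as [t [Ht <-]]; auto.
  rewrite HS; auto. }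
assert (Hder : forall t, s - d <= t <= s + d -> derivable_pt L t).
{ intros t Ht; exists (l t); apply is_derive_Reals; auto. }
assert (DS : derivable_pt S (L s)).
{ unshelve eapply (derivable_pt_recip_interv L S (s - d) (s + d) (L s) Hd' Hu);
    try (intros; now apply Hinv).
  - exact Hder.
  - intros x y H1 H2 H3; apply Hi; auto; apply HO'; lra.
  - rewrite (derive_pt_eq_0 L (S (L s)) (l s)).
    + generalize (Hl s Os); lra.
    + rewrite HS; auto; apply is_derive_Reals; auto. }
destruct DS as [m Hm]; apply is_derive_Reals in Hm.
assert (E : l s * m = 1).
{ assert (D : is_derive (fun t => S (L t)) s (l s * m))
    by exact (is_derive_comp S L s m (l s) Hm (HL s Os)).
  rewrite <- (is_derive_unique _ _ _ D).
  apply is_derive_unique.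
  apply (is_derive_ext_loc (fun t => t)).
  - generalize (HO s Os); apply filter_imp; intros t Ot; symmetry; auto.
  - apply (is_derive_id (K:=R_AbsRing)). }
apply (is_derive_eq _ _ _ _ Hm).
apply (Rmult_eq_reg_l (l s)); [| generalize (Hl s Os); lra].
rewrite E; field; generalize (Hl s Os); lra.
Qed.

(** * Curves in a spherical frame *)

(* [n] is a unit speed spherical curve and [g] its geodesic curvature. *)
Definition sabban (J : R -> Prop) (n e c : R -> vec3) (g : R -> R) : Prop :=
  forall u, J u ->
    (dot3 (n u) (n u) = 1 /\ dot3 (e u) (e u) = 1 /\ dot3 (n u) (e u) = 0 /\
     c u = cross3 (n u) (e u)) /\
    is_derive3 n u (e u) /\
    is_derive3 e u (add3 (scal3 (-1) (n u)) (scal3 (- g u) (c u))) /\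
    is_derive3 c u (scal3 (g u) (e u)).

Lemma cross3_cross3_l u v w :
  cross3 (cross3 u v) w = add3 (scal3 (dot3 u w) v) (scal3 (- dot3 v w) u).
Proof. vec_ring. Qed.

Lemma cross3_cross3_r u v w :
  cross3 u (cross3 v w) = add3 (scal3 (dot3 u w) v) (scal3 (- dot3 u v) w).
Proof. vec_ring. Qed.

(** Differentiating the orthonormality of [n] and [e] forces the components of [d] along [n] and [e]
    to be -1 and 0. Only the component along [c] remains free, and it defines the geodesic curvature
    up to sign. *)
Lemma sabban_intro J n e c (d : R -> vec3) : open J ->
  (forall u, J u -> norm3 (n u) = 1) -> (forall u, J u -> norm3 (e u) = 1) ->
  (forall u, J u -> is_derive3 n u (e u)) ->
  (forall u, J u -> is_derive3 e u (d u)) ->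
  (forall u, J u -> c u = cross3 (n u) (e u)) ->
  sabban J n e c (fun u => - dot3 (d u) (c u)).
Proof.
intros HJ Hn He Dn De Hc u Ju.
assert (nn := dot3_eq1 _ (Hn u Ju)); assert (ee := dot3_eq1 _ (He u Ju)).
assert (orth : forall v, J v -> dot3 (e v) (n v) = 0)
  by (intros v Jv; apply (unit3_derive_orth J n v (e v)); auto).
assert (ne : dot3 (n u) (e u) = 0) by (rewrite dot3_comm; auto).
assert (de : dot3 (d u) (e u) = 0)
  by (apply (unit3_derive_orth J e u (d u)); auto).
assert (dn : dot3 (d u) (n u) = -1).
{ assert (K := dot3_derive_const J e n 0 u (d u) (e u) HJ Ju orth
    (De u Ju) (Dn u Ju)); lra. }
assert (Ed : d u = add3 (scal3 (-1) (n u)) (scal3 (- - dot3 (d u) (c u)) (c u))).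
{ rewrite (orthonormal_expansion (n u) (e u) (d u) nn ee ne) at 1.
  rewrite dn, de, <- Hc by assumption; vec_ring. }
repeat match goal with |- _ /\ _ => split end; auto.
- rewrite <- Ed; auto.
(* In the derivative of [n x e] the term [e x e] vanishes; in [n x d] only the part of [d] along [c]
   survives, and [n x c = - e]. *)
- apply (is_derive3_ext_loc (fun u => cross3 (n u) (e u))).
  + generalize (HJ u Ju); apply filter_imp; intros v Jv; symmetry; auto.
  + apply (is_derive3_eq _ _ _ _ (is_derive3_cross _ _ _ _ _ (Dn u Ju) (De u Ju))).
    rewrite Ed at 1; rewrite (Hc u Ju).
    transitivity (scal3 (dot3 (d u) (cross3 (n u) (e u)))
      (cross3 (n u) (cross3 (n u) (e u)))).
    * rewrite cross3_cross3_r; vec_ring.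
    * rewrite cross3_cross3_r, nn, ne; vec_ring.
Qed.

Lemma sqrt_1_sqr_pos q : 0 < sqrt (1 + q * q).
Proof. apply sqrt_lt_R0; generalize (Rle_0_sqr q); unfold Rsqr; lra. Qed.

Definition frame_speed (a q : R) : R := Rabs a * sqrt (1 + q * q).

Lemma frame_speed_neq0 a q : a <> 0 -> frame_speed a q <> 0.
Proof.
intros Ha; apply Rmult_integral_contrapositive; split.
- now apply Rabs_no_R0.
- generalize (sqrt_1_sqr_pos q); lra.
Qed.

Lemma frame_speed_sqr a q :
  frame_speed a q * frame_speed a q = a * a * (1 + q * q).
Proof.
unfold frame_speed.
replace (a * a) with (Rabs a * Rabs a) by (symmetry; apply Rsqr_abs).
rewrite <- (sqrt_sqrt (1 + q * q)) at 3; [ring |].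
generalize (Rle_0_sqr q); unfold Rsqr; lra.
Qed.

(** The lemmas on [gamma] below use only this velocity, so the integrals defining the curve enter
    just once, in the final theorem. *)
Definition has_frame_velocity (J : R -> Prop) (n c : R -> vec3) (a q : R)
    (gamma : R -> vec3) : Prop :=
  forall u, J u -> is_derive3 gamma u (scal3 a (add3 (n u) (scal3 q (c u)))).

(** Since [n] and [c] are orthonormal, [gamma] has constant speed, and passing to its arc length
    divides derivatives by that constant. *)
Lemma frame_Darc J n e c g a q gamma f u :
  sabban J n e c g -> has_frame_velocity J n c a q gamma -> J u ->
  Darc gamma f u = scal3 (/ frame_speed a q) (Derive3 f u).
Proof.
intros HS Hg Ju; destruct (HS u Ju) as [(nn & ee & ne & Ec) _].
unfold Darc; rewrite (Derive3_eq _ _ _ (Hg u Ju)), norm3_scal.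
f_equal; f_equal; unfold frame_speed, norm3.
apply f_equal, f_equal.
rewrite !dot3_add_l, !dot3_add_r, !dot3_scal_l, !dot3_scal_r, nn.
rewrite (dot3_comm (c u) (n u)), Ec, dot3_cross_l, dot3_cross_self, nn, ee, ne.
ring.
Qed.

Lemma frame_tangent J n e c g a q gamma u :
  sabban J n e c g -> has_frame_velocity J n c a q gamma -> J u ->
  tangent gamma u =
    scal3 (a / frame_speed a q) (add3 (n u) (scal3 q (c u))).
Proof.
intros HS Hg Ju; unfold tangent.
rewrite (frame_Darc J n e c g a q) by assumption.
rewrite (Derive3_eq _ _ _ (Hg u Ju)), scal3_assoc; f_equal.
apply Rmult_comm.
Qed.

(** Both [n] and [c] have derivatives along [e], namely [e] and [g e], so the tangent also turns
    only in the direction [e]. *)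
Lemma frame_Darc_tangent J n e c g a q gamma u :
  open J -> sabban J n e c g -> has_frame_velocity J n c a q gamma -> J u ->
  Darc gamma (tangent gamma) u =
    scal3 (/ frame_speed a q * (a / frame_speed a q * (1 + q * g u))) (e u).
Proof.
intros HJ HS Hg Ju.
rewrite (frame_Darc J n e c g a q), <- scal3_assoc by assumption; f_equal.
apply Derive3_eq.
apply (is_derive3_ext_loc
  (fun u => scal3 (a / frame_speed a q) (add3 (n u) (scal3 q (c u))))).
- generalize (HJ u Ju); apply filter_imp; intros v Jv; symmetry.
  now apply (frame_tangent J n e c g).
- destruct (HS u Ju) as (_ & Dn & _ & Dc).
  eapply is_derive3_eq.
  + apply is_derive3_scal, is_derive3_add; [exact Dn |].
    apply is_derive3_scal; exact Dc.
  + vec_ring.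
Qed.

Lemma frame_curvature J n e c g a q gamma u :
  open J -> sabban J n e c g -> has_frame_velocity J n c a q gamma -> J u ->
  curvature gamma u =
    Rabs (/ frame_speed a q * (a / frame_speed a q * (1 + q * g u))).
Proof.
intros HJ HS Hg Ju; unfold curvature.
rewrite (frame_Darc_tangent J n e c g a q), norm3_scal by assumption.
rewrite (norm3_eq1 (e u)); [ring | now destruct (HS u Ju) as [(_ & ? & _) _]].
Qed.

(* Used with [h = 1 + q g]: a constant sign [d] makes the Frenet normal of
   [gamma] a constant multiple of [e]. *)
Definition has_sign (J : R -> Prop) (h : R -> R) (d : R) : Prop :=
  d * d = 1 /\ forall u, J u -> 0 < d * h u.

Lemma frame_curvature_sign J n e c g a q gamma d u :
  open J -> sabban J n e c g -> has_frame_velocity J n c a q gamma ->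
  a <> 0 -> has_sign J (fun u => 1 + q * g u) d -> J u ->
  curvature gamma u =
    Rabs a * d * (1 + q * g u) / (frame_speed a q * frame_speed a q).
Proof.
intros HJ HS Hg Ha [Hd Hs] Ju.
assert (Hw := frame_speed_neq0 a q Ha).
assert (Hw2 : 0 < frame_speed a q * frame_speed a q)
  by now apply Rsqr_pos_lt.
rewrite (frame_curvature J n e c g a q gamma u) by assumption.
(* The factor [d * d = 1] is inserted so that the positive quantity [d * (1 + q * g u)] appears and
   leaves the absolute value unchanged. *)
replace (/ frame_speed a q * (a / frame_speed a q * (1 + q * g u)))
  with (a * (d * (d * (1 + q * g u)) / (frame_speed a q * frame_speed a q)))
  by (rewrite <- (Rmult_1_l (1 + q * g u)) at 2; rewrite <- Hd; field; auto).
assert (Ed : Rabs d = 1).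
{ rewrite <- sqrt_Rsqr_abs; unfold Rsqr; rewrite Hd; apply sqrt_1. }
unfold Rdiv; rewrite (Rabs_mult a), Rabs_mult, Rabs_mult, Ed.
rewrite (Rabs_pos_eq (d * _)) by (apply Rlt_le, Hs, Ju).
rewrite (Rabs_pos_eq (/ _)) by now apply Rlt_le, Rinv_0_lt_compat.
ring.
Qed.

(** The varying factor [1 + q g] cancels against the curvature; what is left is the sign of [a]
    times [d], a constant. *)
Lemma frame_normal J n e c g a q gamma d u :
  open J -> sabban J n e c g -> has_frame_velocity J n c a q gamma ->
  a <> 0 -> has_sign J (fun u => 1 + q * g u) d -> J u ->
  normal gamma u = scal3 (a * d / Rabs a) (e u).
Proof.
intros HJ HS Hg Ha Hd Ju; unfold normal.
rewrite (frame_curvature_sign J n e c g a q gamma d u),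
  (frame_Darc_tangent J n e c g a q) by assumption.
rewrite scal3_assoc; f_equal.
destruct Hd as [Hd Hs]; specialize (Hs u Ju); simpl in Hs.
assert (1 + q * g u <> 0) by (intros E; rewrite E in Hs; lra).
assert (d <> 0) by (intros E; rewrite E in Hd; lra).
assert (Hw := frame_speed_neq0 a q Ha); assert (Hb := Rabs_no_R0 a Ha).
transitivity (a / (Rabs a * d)); [field; repeat split; assumption |].
rewrite <- (Rmult_1_r a) at 1; rewrite <- Hd; field; auto.
Qed.

Lemma frame_binormal J n e c g a q gamma d u :
  open J -> sabban J n e c g -> has_frame_velocity J n c a q gamma ->
  a <> 0 -> has_sign J (fun u => 1 + q * g u) d -> J u ->
  binormal gamma u =
    scal3 (Rabs a * d / frame_speed a q) (add3 (c u) (scal3 (- q) (n u))).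
Proof.
intros HJ HS Hg Ha Hd Ju; unfold binormal.
rewrite (frame_tangent J n e c g a q), (frame_normal J n e c g a q gamma d)
  by assumption.
destruct (HS u Ju) as [(nn & ee & ne & Ec) _].
assert (Ece : cross3 (c u) (e u) = scal3 (- 1) (n u))
  by (rewrite Ec, cross3_cross3_l, ee, ne; vec_ring).
transitivity (scal3 (a / frame_speed a q * (a * d / Rabs a))
  (add3 (cross3 (n u) (e u)) (scal3 q (cross3 (c u) (e u))))); [vec_ring |].
rewrite Ece, <- Ec.
replace (a / frame_speed a q * (a * d / Rabs a))
  with (Rabs a * d / frame_speed a q); [vec_ring |].
assert (Hw := frame_speed_neq0 a q Ha); assert (Hb := Rabs_no_R0 a Ha).
assert (Hsq : Rabs a * Rabs a = a * a) by (symmetry; apply Rsqr_abs).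
(* Clearing denominators reduces the equality of coefficients to [Rabs a * Rabs a = a * a]. *)
apply (Rmult_eq_reg_r (Rabs a * frame_speed a q));
  [| now apply Rmult_integral_contrapositive].
transitivity (Rabs a * Rabs a * d); [field; auto |].
rewrite Hsq; field; auto.
Qed.

Lemma frame_torsion J n e c g a q gamma d u :
  open J -> sabban J n e c g -> has_frame_velocity J n c a q gamma ->
  a <> 0 -> has_sign J (fun u => 1 + q * g u) d -> J u ->
  torsion gamma u = a * (q - g u) / (frame_speed a q * frame_speed a q).
Proof.
intros HJ HS Hg Ha Hd Ju; unfold torsion.
rewrite (frame_Darc J n e c g a q), (frame_normal J n e c g a q gamma d)
  by assumption.
assert (D : is_derive3 (binormal gamma) u
  (scal3 (Rabs a * d / frame_speed a q * (g u - q)) (e u))).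
{ apply (is_derive3_ext_loc (fun u =>
    scal3 (Rabs a * d / frame_speed a q) (add3 (c u) (scal3 (- q) (n u))))).
  - generalize (HJ u Ju); apply filter_imp; intros v Jv; symmetry.
    now apply (frame_binormal J n e c g).
  - destruct (HS u Ju) as (_ & Dn & _ & Dc).
    eapply is_derive3_eq.
    + apply is_derive3_scal, is_derive3_add; [exact Dc |].
      apply is_derive3_scal; exact Dn.
    + vec_ring. }
rewrite (Derive3_eq _ _ _ D), !dot3_scal_l, dot3_scal_r.
destruct (HS u Ju) as [(_ & -> & _) _].
assert (Hw := frame_speed_neq0 a q Ha); assert (Hb := Rabs_no_R0 a Ha).
(* The sign [d] enters once through the binormal and once through the normal, so the torsion
   contains only its square. *)
transitivity (d * d * (a * (q - g u)) / (frame_speed a q * frame_speed a q)).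
- field; auto.
- rewrite (proj1 Hd), Rmult_1_l; reflexivity.
Qed.

Lemma frame_is_bertrand J n e c g a q gamma d :
  open J -> sabban J n e c g -> has_frame_velocity J n c a q gamma ->
  a <> 0 -> has_sign J (fun u => 1 + q * g u) d -> is_bertrand J gamma.
Proof.
intros HJ HS Hg Ha Hd.
assert (Hb := Rabs_no_R0 a Ha); assert (dd := proj1 Hd).
assert (Hd0 : d <> 0) by (intros E; rewrite E in dd; lra).
(* The offset [a] makes the component of the velocity along [n] cancel. The field [c] serves as unit
   tangent even where the remaining speed [a (q - g)] vanishes. *)
exists (fun u => add3 (gamma u) (scal3 a (e u))), c; intros u Ju.
destruct (HS u Ju) as [(nn & ee & ne & Ec) (Dn & De & Dc)].
rewrite (frame_normal J n e c g a q gamma d u) by assumption.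
split; [| split; [| split; [| split]]].
(* This is the offset [a] measured along the Frenet normal, which is [a * d / Rabs a] times [e]. *)
- exists (Rabs a * d); split; [now apply Rmult_integral_contrapositive |].
  rewrite scal3_assoc; do 2 f_equal.
  rewrite <- (Rmult_1_r a) at 1; rewrite <- dd; field; assumption.
- apply norm3_eq1; rewrite Ec, dot3_cross_self, nn, ee, ne; ring.
- rewrite dot3_scal_r, Ec, dot3_comm, dot3_cross_r; ring.
- exists (a * (q - g u)).
  eapply is_derive3_eq.
  + apply is_derive3_add; [exact (Hg u Ju) | apply is_derive3_scal; exact De].
  + vec_ring.
- exists (g u * (Rabs a * d / a)).
  apply (is_derive3_eq _ _ _ _ Dc).
  rewrite scal3_assoc; f_equal.
  transitivity (g u * (d * d)); [rewrite dd; ring | field; auto].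
Qed.

(** With coefficients [Rabs a * d] and [a * q] the terms in [g] cancel and the numerator becomes
    [a * a * (1 + q * q)], the squared speed. The assumption [q <> 0] makes the torsion coefficient
    nonzero. *)
Lemma frame_bertrand_relation J n e c g a q gamma d :
  open J -> sabban J n e c g -> has_frame_velocity J n c a q gamma ->
  a <> 0 -> q <> 0 -> has_sign J (fun u => 1 + q * g u) d ->
  bertrand_relation J gamma.
Proof.
intros HJ HS Hg Ha Hq Hd.
assert (Hb := Rabs_no_R0 a Ha); assert (dd := proj1 Hd).
assert (Hd0 : d <> 0) by (intros E; rewrite E in dd; lra).
exists (Rabs a * d), (a * q).
split; [now apply Rmult_integral_contrapositive |].
split; [now apply Rmult_integral_contrapositive |].
intros u Ju.
rewrite (frame_curvature_sign J n e c g a q gamma d u),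
  (frame_torsion J n e c g a q gamma d u) by assumption.
assert (Hw := frame_speed_neq0 a q Ha).
assert (Hw2 := frame_speed_sqr a q).
assert (Hsq : Rabs a * Rabs a = a * a) by (symmetry; apply Rsqr_abs).
transitivity (((Rabs a * Rabs a) * (d * d) * (1 + q * g u) +
  a * a * q * (q - g u)) / (frame_speed a q * frame_speed a q)).
- field; auto.
- assert (Hn : Rabs a * Rabs a * (d * d) * (1 + q * g u) + a * a * q * (q - g u)
    = frame_speed a q * frame_speed a q) by (rewrite Hw2, Hsq, dd; ring).
  rewrite Hn; now apply Rinv_r, Rmult_integral_contrapositive.
Qed.

(** * The principal normal and the Darboux vector *)

Definition unit_speed_on (I : R -> Prop) (alpha : R -> vec3) : Prop :=
  forall s, I s -> norm3 (Derive3 alpha s) = 1.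

Lemma Darc_unit_speed I alpha f s :
  unit_speed_on I alpha -> I s -> Darc alpha f s = Derive3 f s.
Proof.
intros U Is; unfold Darc; rewrite (U s Is), Rinv_1; apply scal3_1.
Qed.

Lemma smooth3_on_tangent I alpha : open I ->
  smooth3_on I alpha -> unit_speed_on I alpha -> smooth3_on I (tangent alpha).
Proof.
intros HI Sm U; apply smooth3_on_Darc; auto.
intros s Is; rewrite (U s Is); lra.
Qed.

Lemma smooth3_on_normal I alpha : open I ->
  smooth3_on I alpha -> unit_speed_on I alpha ->
  nonzero_curvature_on I alpha -> smooth3_on I (normal alpha).
Proof.
intros HI Sm U K.
apply (smooth3_on_normalize I (Darc alpha (tangent alpha))); auto.
apply smooth3_on_Darc; auto.
- intros s Is; rewrite (U s Is); lra.
- now apply smooth3_on_tangent.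
Qed.

Lemma norm3_normal gamma t : curvature gamma t <> 0 -> norm3 (normal gamma t) = 1.
Proof. intros K; now apply norm3_unit. Qed.

Lemma tangent_derive I alpha s : open I ->
  smooth3_on I alpha -> unit_speed_on I alpha ->
  nonzero_curvature_on I alpha -> I s ->
  is_derive3 (tangent alpha) s (scal3 (curvature alpha s) (normal alpha s)).
Proof.
intros HI Sm U K Is.
eapply is_derive3_eq.
- apply (smooth3_on_derive I); [now apply smooth3_on_tangent | assumption].
- unfold normal; rewrite scal3_assoc, Rinv_r, scal3_1 by now apply K.
  symmetry; now apply (Darc_unit_speed I).
Qed.

Lemma norm3_tangent I alpha s :
  unit_speed_on I alpha -> I s -> norm3 (tangent alpha s) = 1.
Proof.
intros U Is; unfold tangent; rewrite (Darc_unit_speed I) by assumption; auto.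
Qed.

Lemma tangent_normal_orth I alpha s : open I ->
  smooth3_on I alpha -> unit_speed_on I alpha ->
  nonzero_curvature_on I alpha -> I s ->
  dot3 (tangent alpha s) (normal alpha s) = 0.
Proof.
intros HI Sm U K Is.
assert (D := unit3_derive_orth I (tangent alpha) s _ HI Is
  (fun u Iu => norm3_tangent I alpha u U Iu) (tangent_derive I alpha s HI Sm U K Is)).
rewrite dot3_scal_l, dot3_comm in D.
destruct (Rmult_integral _ _ D) as [D' | D']; [| assumption].
now destruct (K s Is).
Qed.

Lemma normal_derive I alpha s : open I ->
  smooth3_on I alpha -> unit_speed_on I alpha ->
  nonzero_curvature_on I alpha -> I s ->
  Derive3 (normal alpha) s =
    add3 (scal3 (- curvature alpha s) (tangent alpha s))
         (scal3 (torsion alpha s) (binormal alpha s)).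
Proof.
intros HI Sm U K Is.
assert (DT := tangent_derive I alpha s HI Sm U K Is).
assert (SN := smooth3_on_normal I alpha HI Sm U K).
assert (DN := smooth3_on_derive I _ s SN Is).
assert (TT := dot3_eq1 _ (norm3_tangent I alpha s U Is)).
assert (NN := dot3_eq1 _ (norm3_normal alpha s (K s Is))).
assert (TN := tangent_normal_orth I alpha s HI Sm U K Is).
assert (E1 : dot3 (Derive3 (normal alpha) s) (normal alpha s) = 0).
{ apply (unit3_derive_orth I (normal alpha) s); auto.
  intros u Iu; apply norm3_normal; auto. }
assert (E2 : dot3 (Derive3 (normal alpha) s) (tangent alpha s)
  = - curvature alpha s).
{ assert (E := dot3_derive_const I (tangent alpha) (normal alpha) 0 s _ _ HI Is
    (fun u Iu => tangent_normal_orth I alpha u HI Sm U K Iu) DT DN).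
  rewrite dot3_scal_l, NN in E; rewrite dot3_comm; lra. }
(* Torsion is defined through [B']. In [B' = T' x N + T x N'] the first term is orthogonal to [N],
   and the product of the second with [N] is minus that of [N'] with [B]. *)
assert (E3 : torsion alpha s
  = dot3 (Derive3 (normal alpha) s) (binormal alpha s)).
{ unfold torsion; rewrite (Darc_unit_speed I) by assumption.
  assert (DB := is_derive3_cross _ _ _ _ _ DT DN); apply Derive3_eq in DB.
  change (fun u => cross3 (tangent alpha u) (normal alpha u))
    with (binormal alpha) in DB.
  rewrite DB.
  unfold binormal; vec_unfold; ring. }
rewrite (orthonormal_expansion _ _ (Derive3 (normal alpha) s) TT NN TN) at 1.
unfold binormal in E3; unfold binormal; rewrite E1, E2, <- E3; vec_ring.
Qed.

(** Insert [N' = - kappa T + tau B] and use [N x T = - B] and [N x B = T]. This identifies the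
    Darboux direction with the third vector of the spherical frame of [N]. *)
Lemma darboux_cross I alpha s : open I ->
  smooth3_on I alpha -> unit_speed_on I alpha ->
  nonzero_curvature_on I alpha -> I s ->
  darboux alpha s = cross3 (normal alpha s) (Derive3 (normal alpha) s).
Proof.
intros HI Sm U K Is.
rewrite (normal_derive I) by assumption; unfold darboux, binormal.
assert (NN := dot3_eq1 _ (norm3_normal alpha s (K s Is))).
assert (TN := tangent_normal_orth I alpha s HI Sm U K Is).
transitivity (add3
  (scal3 (curvature alpha s) (cross3 (tangent alpha s) (normal alpha s)))
  (scal3 (torsion alpha s) (cross3 (normal alpha s)
    (cross3 (tangent alpha s) (normal alpha s))))); [| vec_ring].
rewrite cross3_cross3_r, NN, (dot3_comm (normal alpha s)), TN.
vec_ring.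
Qed.

(** The squared norm of [N'] is [kappa^2 + tau^2], which is positive, so the indicatrix is a regular
    curve. *)
Lemma normal_derive_neq0 I alpha s : open I ->
  smooth3_on I alpha -> unit_speed_on I alpha ->
  nonzero_curvature_on I alpha -> I s ->
  norm3 (Derive3 (normal alpha) s) <> 0.
Proof.
intros HI Sm U K Is E.
assert (TT := dot3_eq1 _ (norm3_tangent I alpha s U Is)).
assert (NN := dot3_eq1 _ (norm3_normal alpha s (K s Is))).
assert (TN := tangent_normal_orth I alpha s HI Sm U K Is).
assert (E' : dot3 (Derive3 (normal alpha) s) (Derive3 (normal alpha) s) = 0)
  by (rewrite <- norm3_sqr, E; ring).
rewrite (normal_derive I) in E' by assumption.
unfold binormal in E'.
rewrite !dot3_add_l, !dot3_add_r, !dot3_scal_l, !dot3_scal_r in E'.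
rewrite dot3_cross_self, (dot3_comm (cross3 _ _)), dot3_cross_l, TT, NN, TN in E'.
assert (H := Rsqr_pos_lt _ (K s Is)).
assert (H' := Rle_0_sqr (torsion alpha s)).
unfold Rsqr in *; lra.
Qed.

Lemma unit_darboux_cross I alpha s : open I ->
  smooth3_on I alpha -> unit_speed_on I alpha ->
  nonzero_curvature_on I alpha -> I s ->
  unit_darboux alpha s =
    cross3 (normal alpha s)
      (scal3 (/ norm3 (Derive3 (normal alpha) s)) (Derive3 (normal alpha) s)).
Proof.
intros HI Sm U K Is; unfold unit_darboux.
rewrite (darboux_cross I) by assumption.
assert (SN := smooth3_on_normal I alpha HI Sm U K).
assert (E : norm3 (cross3 (normal alpha s) (Derive3 (normal alpha) s))
  = norm3 (Derive3 (normal alpha) s)).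
{ unfold norm3 at 1; rewrite dot3_cross_self.
  rewrite (dot3_eq1 _ (norm3_normal alpha s (K s Is))).
  rewrite (dot3_comm (normal alpha s)), (unit3_derive_orth I (normal alpha) s); auto.
  - unfold norm3; f_equal; ring.
  - intros u Iu; apply norm3_normal; auto.
  - now apply (smooth3_on_derive I). }
rewrite E; vec_ring.
Qed.

(** * Passage to the arc length of the indicatrix *)

Lemma is_derive3_RInt3 (J : R -> Prop) f a x :
  open J -> convex J -> (forall t, J t -> exists v, is_derive3 f t v) ->
  J a -> J x -> is_derive3 (fun y => RInt3 f a y) x (f x).
Proof.
intros HJ HC Hf Ja Jx.
assert (Hc := ex_derive_continuous (K:=R_AbsRing) (V:=R_NormedModule)).
split; [| split].
- apply (is_derive_RInt_convex J (fun u => x1 (f u)) a x HJ HC); auto.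
  intros t Jt; apply Hc; destruct (Hf t Jt) as [v (H & _ & _)]; now exists (x1 v).
- apply (is_derive_RInt_convex J (fun u => x2 (f u)) a x HJ HC); auto.
  intros t Jt; apply Hc; destruct (Hf t Jt) as [v (_ & H & _)]; now exists (x2 v).
- apply (is_derive_RInt_convex J (fun u => x3 (f u)) a x HJ HC); auto.
  intros t Jt; apply Hc; destruct (Hf t Jt) as [v (_ & _ & H)]; now exists (x3 v).
Qed.

Theorem theorem4 :
  forall (lo hi : Rbar) (alpha : R -> vec3) (s_of : R -> R)
         (a theta : R) (c : vec3) (sigma0 : R),
  let I := in_interval lo hi in
  let J := indicatrix_domain I alpha in
  let gamma := gamma_N alpha s_of a theta c sigma0 in
  I 0 ->
  smooth3 I alpha ->
  (forall s, I s -> norm3 (Derive3 alpha s) = 1) ->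
  nonzero_curvature_on I alpha ->
  (forall s, I s -> s_of (indicatrix_arclength alpha s) = s) ->
  sin theta <> 0 ->
  J sigma0 ->
  regular_on J gamma ->
  nonzero_curvature_on J gamma ->
  is_bertrand J gamma /\
  (cos theta <> 0 -> bertrand_relation J gamma).
Proof.
intros lo hi alpha s_of a theta c sigma0 I J gamma I0 Sm0 U K Hs Hsin J0 Reg Kg.
assert (HI : open I) by apply in_interval_open.
assert (CI : convex I) by apply in_interval_convex.
assert (Sm := smooth3_smooth3_on I alpha Sm0).
assert (SN := smooth3_on_normal I alpha HI Sm U K).
set (L := indicatrix_arclength alpha) in *.
set (N := normal alpha) in *.
set (w := fun s => norm3 (Derive3 N s)).
assert (Hw : forall s, I s -> w s <> 0)
  by (intros; now apply (normal_derive_neq0 I)).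
assert (Hw0 : forall s, I s -> 0 < w s).
{ intros s Is; destruct (norm3_ge0 (Derive3 N s)) as [| E]; [assumption |].
  now destruct (Hw s Is). }
assert (SN' := smooth3_on_Derive3 I N SN).
assert (HL : forall s, I s -> is_derive L s (w s)).
{ intros s Is; apply (is_derive_RInt_convex I w 0 s HI CI); auto.
  intros t It; apply (smooth_on_continuous I); [| assumption].
  now apply smooth_on_norm3. }
(* The unit tangent of the indicatrix, still as a function of the parameter [s] of [alpha]. *)
set (E := fun s => scal3 (/ w s) (Derive3 N s)).
assert (SE : smooth3_on I E) by now apply smooth3_on_normalize.
set (C := unit_darboux alpha) in *.
assert (HC : forall s, I s -> C s = cross3 (N s) (E s))
  by (intros; now apply (unit_darboux_cross I)).
assert (SC : smooth3_on I (fun s => cross3 (N s) (E s)))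
  by now apply smooth3_on_cross.
assert (HJ : open J) by exact (image_open I L w HI CI HL Hw0).
assert (CJ : convex J) by exact (image_convex I L w CI HL Hw0).
assert (Ds : forall u, J u -> I (s_of u) /\ is_derive s_of u (/ w (s_of u))).
{ intros u [s [Is <-]]; fold L; rewrite Hs by assumption; split; [assumption |].
  now apply (is_derive_left_inverse I L w s_of). }
set (d := fun s => scal3 (/ w s) (Derive3 E s)).
set (G := fun s => - dot3 (d s) (C s)).
(* The chain rule factor [/ w] of [s_of] turns the derivative of [N] into [E] and that of [E] into
   [d]. *)
assert (HS : sabban J (fun u => N (s_of u)) (fun u => E (s_of u))
  (fun u => C (s_of u)) (fun u => G (s_of u))).
{ apply (sabban_intro J _ _ _ (fun u => d (s_of u)) HJ);
    intros u Ju; destruct (Ds u Ju) as [Iu Du].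
  - apply norm3_normal; auto.
  - apply norm3_unit, Hw, Iu.
  - exact (is_derive3_comp N s_of u _ _ (smooth3_on_derive I N _ SN Iu) Du).
  - exact (is_derive3_comp E s_of u _ _ (smooth3_on_derive I E _ SE Iu) Du).
  - auto. }
set (q := cos theta / sin theta).
assert (Hg : has_frame_velocity J (fun u => N (s_of u)) (fun u => C (s_of u))
  a q gamma).
{ intros u Ju; eapply is_derive3_eq.
  - apply is_derive3_add; [apply is_derive3_add | apply is_derive3_const];
      apply is_derive3_scal; apply (is_derive3_RInt3 J); auto;
      intros v Jv; destruct (HS v Jv) as (_ & Dn & _ & Dc).
    + exists (E (s_of v)); exact Dn.
    + exists (scal3 (G (s_of v)) (E (s_of v))); exact Dc.
  - fold N C q; vec_ring. }
(* For [a = 0] the velocity would vanish at [sigma0], against regularity. *)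
assert (Ha : a <> 0).
{ intros Ea; apply (Reg sigma0 J0).
  rewrite (Derive3_eq _ _ _ (Hg sigma0 J0)), Ea; vec_ring. }
(* The curvature of [gamma] at [L s] has [1 + q * G s] as a factor, so a zero would contradict
   nonvanishing curvature. *)
assert (H1 : forall s, I s -> 1 + q * G s <> 0).
{ intros s Is E0.
  assert (Js : J (L s)) by (exists s; split; [assumption | reflexivity]).
  apply (Kg (L s) Js).
  rewrite (frame_curvature J _ _ _ _ a q gamma (L s) HJ HS Hg Js).
  rewrite Hs, E0, !Rmult_0_r by assumption; apply Rabs_R0. }
assert (SG : smooth_on I (fun s => 1 + q * G s)).
(* [C] is known to equal [N x E] on [I], so smoothness is established for the cross product and then
   transferred. *)
{ apply (smooth_on_ext I
    (fun s => 1 + - q * dot3 (d s) (cross3 (N s) (E s))) _ HI).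
  - intros s Is; unfold G; rewrite HC by assumption; ring.
  - apply smooth_on_add; [assumption | now apply smooth_on_const |].
    apply smooth_on_mul; [assumption | now apply smooth_on_const |].
    apply smooth_on_dot3; auto; apply smooth3_on_scal; auto.
    + apply smooth_on_inv; auto; now apply smooth_on_norm3.
    + now apply smooth3_on_Derive3. }
(* The sign is read off at the parameter 0 and spreads over the interval [I] by continuity and
   nonvanishing. *)
assert (Hd : exists k, k * k = 1 /\ 0 < k * (1 + q * G 0)).
{ destruct (Rdichotomy _ _ (H1 0 I0)); [exists (-1) | exists 1]; split; lra. }
destruct Hd as [k [Hk Hk0]].
assert (Hsgn : has_sign J (fun u => 1 + q * G (s_of u)) k).
{ split; [assumption |]; intros u Ju; destruct (Ds u Ju) as [Iu _].
  apply (nonzero_same_sign I (fun s => k * (1 + q * G s)) 0 (s_of u) CI); auto.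
  - intros t It; apply (smooth_on_continuous I); [| assumption].
    apply smooth_on_mul; auto; now apply smooth_on_const.
  - intros t It; apply Rmult_integral_contrapositive; split; auto.
    intros Ek; rewrite Ek in Hk; lra. }
split.
- now apply (frame_is_bertrand J _ _ _ _ a q gamma k HJ HS Hg).
- intros Hcos; apply (frame_bertrand_relation J _ _ _ _ a q gamma k HJ HS Hg); auto.
  apply Rmult_integral_contrapositive; split; [assumption |].
  now apply Rinv_neq_0_compat.
Qed.
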